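(* Let $M_c$ be a melon graph that is a comparability graph. If all the constituent paths of $M_c$ are of even length, then $\mathcal{R}^p(M_c)\le 3$.
   Context: All graphs are finite and simple. A melon graph $M=(E_1,\ldots,E_m)$ ($m\ge 1$) is the graph formed as the union of $m$ paths $E_1,\ldots,E_m$ (the constituent paths), all having the same two distinct endpoints $0$ and $0'$, and pairwise sharing no vertices other than $0$ and $0'$; since $M$ is simple, at most one constituent path has length one (length = number of edges). A comparability graph is a graph admitting a transitive orientation. Two letters $a\neq b$ alternate in a word $w$ if the subword of $w$ consisting of all occurrences of $a$ and $b$ is of the form $abab\cdots$ or $baba\cdots$. A word $w$ represents a graph $G=(V,E)$ if for all distinct $a,b\in V$: $\{a,b\}\in E$ if and only if $a$ and $b$ alternate in $w$. $G$ is permutationally $k$-representable if it is represented by a word $p_1p_2\cdots p_k$ where each $p_i$ is a permutation of $V$ (a word containing each vertex exactly once); such a $k$ exists exactly for comparability graphs. The permutation-representation number $\mathcal{R}^p(G)$ of a comparability graph $G$ is the smallest such $k$. *)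

(* Defs.v *)
(* MathComp development. *)
From mathcomp Require Import all_boot.

Set Implicit Arguments.
Unset Strict Implicit.
Unset Printing Implicit Defensive.

Record sgraph := SGraph {
  vertex :> finType;
  adj : rel vertex;
  adj_sym : symmetric adj;
  adj_irr : irreflexive adj
}.

Definition transitive_orientation (G : sgraph) (r : rel G) : Prop :=
  [/\ forall x y : G, adj x y = r x y || r y x,
      forall x y : G, ~~ (r x y && r y x)
    & transitive r].

Definition comparability_graph (G : sgraph) : Prop :=
  exists r : rel G, transitive_orientation r.

(* The path with vertex sequence o :: p; its length (number of edges)
   is size p. *)
Definition simple_path_between (T : eqType) (o o' : T) (p : seq T) : Prop :=
  uniq (o :: p) /\ last o p = o'.

Definition path_edge (T : eqType) (o : T) (p : seq T) (x y : T) : bool :=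
  infix [:: x; y] (o :: p) || infix [:: y; x] (o :: p).

(* G is the melon graph (E_1, ..., E_m) with common endpoints o and o',
   the i-th constituent path having vertex sequence o :: E i. The last two
   clauses say that G is the union of these paths. *)
Definition melon_graph (G : sgraph) (o o' : G) (m : nat)
    (E : 'I_m -> seq G) : Prop :=
  [/\ 0 < m /\ o != o',
      forall i, simple_path_between o o' (E i),
      (forall i j x, i != j -> x \in o :: E i -> x \in o :: E j ->
         x = o \/ x = o') /\
      (forall i j, size (E i) = 1 -> size (E j) = 1 -> i = j),
      forall x : G, exists i, x \in o :: E i
    & forall x y : G, adj x y <-> exists i, path_edge o (E i) x y].

(* a b a b ... with n letters *)
Definition alt_word (T : Type) (a b : T) (n : nat) : seq T :=
  mkseq (fun i => if odd i then b else a) n.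

Definition alternate (T : eqType) (a b : T) (w : seq T) : Prop :=
  let u := [seq x <- w | (x == a) || (x == b)] in
  u = alt_word a b (size u) \/ u = alt_word b a (size u).

Definition represents (G : sgraph) (w : seq G) : Prop :=
  forall a b : G, a != b -> (adj a b <-> alternate a b w).

(* k = 0 is excluded: the empty word would represent every complete graph. *)
Definition perm_representable (G : sgraph) (k : nat) : Prop :=
  0 < k /\
  exists p : k.-tuple (seq G),
    (forall i, perm_eq (tnth p i) (enum G)) /\ represents (flatten p).

(* R^p(G) = k *)
Definition is_perm_rep_number (G : sgraph) (k : nat) : Prop :=
  perm_representable G k /\ forall j, perm_representable G j -> k <= j.

(* Main.v *)
From Stdlib Require Import Classical.
Require Import Defs.
From mathcomp Require Import all_boot zify.

Set Implicit Arguments.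
Unset Strict Implicit.
Unset Printing Implicit Defensive.

(** All constituent paths have even length, so the positions along the paths
    two-colour the graph: call a vertex upper when its position is odd, lower
    when it is even.  Both ends [o] and [o'] are lower, and every upper vertex
    has exactly two neighbours, both lower.  The graph is therefore the
    subdivision of a multigraph on the lower vertices, and orienting each edge
    upwards gives the incidence poset of that multigraph.  Words made of [k]
    permutations that represent the graph are the same thing as [k] linear
    orders whose common comparabilities are exactly the edges, that is,
    a realizer of this poset ([perm_representable_of_keys]).

    By an idea of Schnyder ([schnyder]) it suffices to rank the lower vertices
    in three ways such that each lower vertex rises, in some ranking, above
    both ends of any subdivided edge that does not contain it, and such that
    any two lower vertices are ranked both ways.  For the melon graph take the
    inner lower vertices in blocks, one block for each constituent path:
    - ranking 1 is [o'], then the blocks in increasing order, each of them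
      traversed from [o'] towards [o], then [o];
    - ranking 2 is [o], then the blocks in increasing order, each of them
      traversed from [o] towards [o'], then [o'];
    - ranking 3 puts [o] and [o'] at the bottom, followed by the inner vertices
      in the reverse of their order in ranking 2.
    The end [o] is above everything in ranking 1 and [o'] in ranking 2.  An inner
    vertex is above every edge of the later blocks in ranking 3, and above
    every edge of the earlier blocks in one of the three rankings, depending on
    which of [o] and [o'] the edge contains.  Within its own block, it is above
    the edges on its [o'] side in ranking 1 and above those on its [o] side
    in ranking 2 ([rank_above]). *)

(** * Words that are concatenations of permutations *)

Lemma alt_wordSS (T : Type) (a b : T) n :
  alt_word a b n.+2 = [:: a, b & alt_word a b n].
Proof.
rewrite /alt_word /mkseq /= (iotaDl 2 0) -map_comp.
by congr [:: _, _ & _]; apply: eq_map => i /=; rewrite negbK.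
Qed.

(** The restriction of [p_1 ... p_k] to two letters is a concatenation of [k]
    two-letter blocks; it alternates precisely when all the blocks agree. *)
Lemma flatten_pairs_alt_word (T : eqType) (a b : T) (ss : seq (seq T)) :
  a != b -> all (mem [:: [:: a; b]; [:: b; a]]) ss ->
  let u := flatten ss in
  (u = alt_word a b (size u)) <-> all (pred1 [:: a; b]) ss.
Proof.
move=> ab; elim: ss => [|s ss IH] //= /andP[].
rewrite !inE => /orP[]/eqP -> /IH {}IH /=; rewrite alt_wordSS.
  by rewrite eqxx; split=> [[] /IH|/IH {1}->].
split=> [[/eqP]|]; first by rewrite eq_sym (negPf ab).
by case: eqP => // -[/eqP]; rewrite eq_sym (negPf ab).
Qed.

(** The [j]-th permutation sorts the vertices by their [j]-th key.  Sorting
    commutes with restriction to two letters, so block [j] of the restricted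
    word shows which of the two has the smaller [j]-th key. *)
Lemma perm_representable_of_keys (G : sgraph) k (key : 'I_k -> G -> nat) :
  0 < k -> (forall j, injective (key j)) ->
  (forall a b : G, a != b ->
     adj a b = [forall j, key j a < key j b] || [forall j, key j b < key j a]) ->
  perm_representable G k.
Proof.
move=> k0 inj hadj; split=> //.
pose le j := relpre (key j) leq.
have le_tot j : total (le j) by move=> x y; apply: leq_total.
have le_tr j : transitive (le j) by move=> y x z; apply: leq_trans.
have le_as j : antisymmetric (le j).
  by move=> x y; rewrite /le /= -eqn_leq => /eqP/inj.
exists [tuple sort (le j) (enum G) | j < k]; split=> [i|a b ab].
  by rewrite tnth_mktuple perm_sort.
rewrite /alternate filter_flatten -map_comp.
set ss := map _ _.
have -> : ss = [seq if key j a < key j b then [:: a; b] else [:: b; a] | j <- enum 'I_k].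
  apply: eq_map => j /=; rewrite filter_sort //.
  have -> : sort (le j) [seq x <- enum G | (x == a) || (x == b)]
            = sort (le j) [:: a; b].
    apply/perm_sortP => //; apply: uniq_perm.
    - by rewrite filter_uniq ?enum_uniq.
    - by rewrite /= inE ab.
    - by move=> x; rewrite mem_filter mem_enum !inE andbT.
  rewrite /sort /= /le /= ltn_neqAle; case: leqP => //; rewrite ?andbT ?andbF //.
  by rewrite (inj_eq (@inj j)) ab.
set tt := (X in flatten X).
have ab' : b != a by rewrite eq_sym.
have two : all (mem [:: [:: a; b]; [:: b; a]]) tt.
  by apply/allP => _ /mapP[j _ ->]; rewrite !inE; case: ifP; rewrite eqxx ?orbT.
have two' : all (mem [:: [:: b; a]; [:: a; b]]) tt.
  by apply/allP => s /(allP two); rewrite !inE orbC.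
have -> : adj a b <-> all (pred1 [:: a; b]) tt \/ all (pred1 [:: b; a]) tt.
  have nab : ([:: b; a] == [:: a; b]) = false.
    by apply/eqP => -[/eqP]; rewrite (negPf ab').
  rewrite hadj // !all_map; split.
    case/orP => /forallP h; [left|right]; apply/allP => j _ /=; move: (h j).
      by move->.
    by rewrite ltnNge leq_eqVlt negb_or => /andP[_ /negPf ->].
  case=> /allP h; apply/orP; [left|right]; apply/forallP => j;
    have := h j; rewrite -enumT mem_enum => /(_ isT) /=; case: ltngtP => //.
  - by rewrite nab.
  - by rewrite nab.
  - by rewrite eq_sym nab.
  - by move/inj/eqP; rewrite (negPf ab).
by rewrite -!flatten_pairs_alt_word.
Qed.

(** Excluded middle provides the least number without a search through the
    finitely many tuples of permutations. *)
Lemma is_perm_rep_number_le (G : sgraph) n :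
  perm_representable G n -> exists k, is_perm_rep_number G k /\ k <= n.
Proof.
elim/ltn_ind: n => n IH hn.
case: (classic (exists2 j, j < n & perm_representable G j)) => [[j jn hj]|hno].
  by have [k [hk kj]] := IH j jn hj; exists k; split=> //; lia.
exists n; do 2!split=> //; move=> j hj.
by rewrite leqNgt; apply/negP => jn; apply: hno; exists j.
Qed.

(** * Realizers of incidence posets *)

(** Lexicographic comparison of pairs with second component below [n], encoded
    as comparison of numbers. *)
Definition lex n (hi lo : nat) := hi * n + lo.

Lemma ltn_lex_hi n i i' p p' : p < n -> i < i' -> lex n i p < lex n i' p'.
Proof. by rewrite /lex => pn ii'; nia. Qed.

(** If [G] subdivides a multigraph, [e1 b] and [e2 b] being the ends of the edge
    whose subdivision vertex is [b], then in each order [b] is placed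
    immediately above the higher of its two ends.  This makes [b] larger than
    both ends in all the orders; every other pair has to be reversed between
    two orders.  Two edges that are not parallel each have an end outside the
    other, which pulls its own subdivision vertex above the other one in some
    order.  Subdivision vertices of parallel edges have the same height in every
    order, and the tie is broken in opposite ways in the first and the last. *)
Lemma schnyder (G : sgraph) k (upper : pred G) (e1 e2 : G -> G)
    (r : 'I_k.+2 -> G -> nat) :
  (forall b, upper b -> ~~ upper (e1 b)) ->
  (forall b, upper b -> ~~ upper (e2 b)) ->
  (forall b, upper b -> e1 b != e2 b) ->
  (forall a b, ~~ upper a -> ~~ upper b -> ~~ adj a b) ->
  (forall a b, upper b -> adj a b = (a == e1 b) || (a == e2 b)) ->
  (forall a a', ~~ upper a -> ~~ upper a' -> a != a' -> exists j, r j a < r j a') ->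
  (forall a b, ~~ upper a -> upper b -> a != e1 b -> a != e2 b ->
     exists j, maxn (r j (e1 b)) (r j (e2 b)) < r j a) ->
  perm_representable G k.+2.
Proof.
move=> low1 low2 e12 hlow hup hinc habove.
(* Doubling leaves a free slot just above each lower vertex. *)
pose base j x :=
  if upper x then (maxn (r j (e1 x)) (r j (e2 x))).*2.+1 else (r j x).*2.
pose tie (j : 'I_k.+2) x : 'I_#|G| :=
  if j == ord0 then enum_rank x else rev_ord (enum_rank x).
have rev_lt n (u v : 'I_n) : rev_ord u < rev_ord v -> v < u.
  by rewrite /=; move: (ltn_ord u) (ltn_ord v); lia.
pose key j x := lex #|G| (base j x) (tie j x).
have key_lt j x y : base j x < base j y -> key j x < key j y.
  by move=> h; apply: ltn_lex_hi.
have tie_inj j : injective (tie j).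
  move=> x y; rewrite /tie; case: ifP => _; first exact: enum_rank_inj.
  by move/rev_ord_inj/enum_rank_inj.
have key_inj j : injective (key j).
  move=> x y exy; have bxy : base j x = base j y.
    by case: (ltngtP (base j x) (base j y)) => // /key_lt; rewrite exy ltnn.
  by move: exy; rewrite /key /lex bxy => /addnI/val_inj/tie_inj.
pose P a b := [forall j, key j a < key j b].
have notP a b : (exists j, base j b < base j a) -> P a b = false.
  case=> j /key_lt h; apply/negP => /forallP/(_ j); lia.
apply: (@perm_representable_of_keys _ _ key) => // a b ab; rewrite -!/(P _ _).
have low_low x y : ~~ upper x -> ~~ upper y -> x != y -> P x y = false.
  move=> hx hy xy; apply: notP; rewrite eq_sym in xy.
  have [j hj] := hinc y x hy hx xy.
  by exists j; rewrite /base (negPf hx) (negPf hy); lia.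
have low_up x y : ~~ upper x -> upper y -> adj x y = P x y || P y x.
  move=> hx hy.
  have -> : P y x = false.
    apply: notP; suff [j hj] : exists j, r j x < maxn (r j (e1 y)) (r j (e2 y)).
      by exists j; rewrite /base (negPf hx) hy; lia.
    case: (altP (x =P e1 y)) => [xe|ne].
      have [|j hj] := hinc x (e2 y) hx (low2 _ hy); first by rewrite xe e12.
      by exists j; lia.
    by have [j hj] := hinc x (e1 y) hx (low1 _ hy) ne; exists j; lia.
  rewrite orbF hup //; apply/idP/idP.
    move=> h; apply/forallP => j; apply: key_lt; rewrite /base (negPf hx) hy.
    by case/orP: h => /eqP ->; lia.
  apply: contraTT => /norP[n1 n2]; apply/negbT/notP.
  by have [j hj] := habove x y hx hy n1 n2; exists j; rewrite /base (negPf hx) hy; lia.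
have up_up x y : upper x -> upper y -> x != y -> P x y = false.
  move=> hx hy xy.
  have outside e : ~~ upper e -> (e == e1 x) || (e == e2 x) ->
      ~~ ((e == e1 y) || (e == e2 y)) -> P x y = false.
    move=> he hex /norP[n1 n2]; apply: notP; have [j hj] := habove e y he hy n1 n2.
    by exists j; rewrite /base hx hy; case/orP: hex => /eqP ex; rewrite ex in hj; lia.
  case: (boolP ((e1 x == e1 y) || (e1 x == e2 y))) => [h1|/outside]; last first.
    by apply; rewrite ?low1 ?eqxx.
  case: (boolP ((e2 x == e1 y) || (e2 x == e2 y))) => [h2|/outside]; last first.
    by apply; rewrite ?low2 ?eqxx ?orbT.
  (* The ends of [x] are those of [y]: parallel edges. *)
  have beq j : base j x = base j y.
    rewrite /base hx hy; have := e12 _ hx.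
    case/orP: h1 => /eqP ->; case/orP: h2 => /eqP ->; rewrite ?eqxx // => _.
    by rewrite maxnC.
  apply/negP => /forallP h; have := h ord0; have := h ord_max.
  rewrite /key /lex !beq !ltn_add2l /tie eqxx -[ord_max == ord0]/false.
  by move/rev_lt; lia.
case: (boolP (upper a)) (boolP (upper b)) => ha [] hb.
- rewrite hup // !up_up //; last by rewrite eq_sym.
  by apply/norP; split; apply: contraTneq ha => ->; rewrite ?low1 ?low2.
- by rewrite adj_sym low_up // orbC.
- exact: low_up.
- rewrite (negPf (hlow _ _ ha hb)) !low_low //; by rewrite eq_sym.
Qed.

(** * Melon graphs with paths of even length *)

Lemma infix2P (T : eqType) (x0 x y : T) (s : seq T) :
  infix [:: x; y] s <->
  exists q, [/\ q.+1 < size s, nth x0 s q = x & nth x0 s q.+1 = y].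
Proof.
split=> [/infixP[s1 [s2 ->]]|[q [hq <- <-]]].
  exists (size s1); rewrite size_cat /=; split; first by lia.
    by rewrite nth_cat ltnn subnn.
  by rewrite nth_cat ltnNge leqnSn /= subSn ?subnn.
apply/infixP; exists (take q s), (drop q.+2 s).
by rewrite -[LHS](cat_take_drop q) (drop_nth x0) ?(drop_nth x0 hq) //; lia.
Qed.

Section EvenMelon.

Variables (G : sgraph) (o o' : G) (m : nat) (E : 'I_m -> seq G).
Hypothesis hmelon : melon_graph o o' E.
Hypothesis heven : forall i, ~~ odd (size (E i)).

Definition vtx i p := nth o (o :: E i) p.

Lemma vtx_size i : vtx i (size (E i)) = o'.
Proof.
have [_ /(_ i)[_ <-] _ _ _] := hmelon.
by rewrite /vtx -[size _]/(size (o :: E i)).-1 nth_last.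
Qed.

Lemma vtx_inj i p q :
  p <= size (E i) -> q <= size (E i) -> vtx i p = vtx i q -> p = q.
Proof.
have [_ /(_ i)[u _] _ _ _] := hmelon.
by move=> hp hq /eqP; rewrite /vtx nth_uniq // => /eqP.
Qed.

Lemma vtx_mem i p : p <= size (E i) -> vtx i p \in o :: E i.
Proof. by move=> hp; apply: mem_nth. Qed.

Lemma melon_adjP x y :
  adj x y <-> exists i p, p < size (E i) /\
    ((x = vtx i p /\ y = vtx i p.+1) \/ (y = vtx i p /\ x = vtx i p.+1)).
Proof.
have [_ _ _ _ ->] := hmelon; split=> -[i].
  by case/orP => /(infix2P o) [p [hp <- <-]]; exists i, p; split=> //; [left|right].
case=> p [hp h]; exists i; apply/orP.
by case: h => -[-> ->]; [left|right]; apply/(infix2P o); exists p.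
Qed.

(** [o] and [o'] lie on every path, so their block is an arbitrary choice. *)
Variable blk : G -> 'I_m.
Hypothesis hblk : forall x, x \in o :: E (blk x).

Definition pos x := index x (o :: E (blk x)).

Lemma vtx_pos x : vtx (blk x) (pos x) = x.
Proof. exact: nth_index. Qed.

Lemma pos_le x : pos x <= size (E (blk x)).
Proof. by have := hblk x; rewrite -index_mem. Qed.

Lemma pos_lt_card x : pos x < #|G|.
Proof.
have [_ /(_ (blk x))[u _] _ _ _] := hmelon.
have := hblk x; rewrite -index_mem -(card_uniqP u) => h.
exact: leq_trans h (max_card _).
Qed.

Lemma pos_o : pos o = 0.
Proof. by rewrite /pos /= eqxx. Qed.

Lemma pos_o' : pos o' = size (E (blk o')).
Proof.
by apply: (@vtx_inj (blk o')) => //; rewrite ?pos_le // vtx_pos vtx_size.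
Qed.

(** Distinct paths share no inner vertex, so the coordinates of an inner vertex
    are forced. *)
Lemma vtx_inner i p : 0 < p < size (E i) ->
  [/\ vtx i p != o, vtx i p != o', blk (vtx i p) = i & pos (vtx i p) = p].
Proof.
move=> /andP[p0 ps]; have pl := ltnW ps.
have no : vtx i p != o.
  by apply/eqP => /(@vtx_inj i p 0 pl isT); lia.
have no' : vtx i p != o'.
  by apply/eqP; rewrite -(vtx_size i) => /(vtx_inj pl (leqnn _)); lia.
have bi : blk (vtx i p) = i.
  have [_ _ [disj _] _ _] := hmelon.
  apply/eqP/negPn/negP => ne.
  case: (disj _ _ _ ne (hblk _) (vtx_mem pl)) => /eqP; first by rewrite (negPf no).
  by rewrite (negPf no').
split=> //; have := vtx_pos (vtx i p); have := pos_le (vtx i p).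
by rewrite bi => hle; apply: vtx_inj.
Qed.

(** Even lengths make the parity of the position independent of the chosen
    path: [o'] is at the end of all of them. *)
Lemma odd_pos_vtx i p : p <= size (E i) -> odd (pos (vtx i p)) = odd p.
Proof.
case: p => [|p] hp; first by rewrite /vtx /= pos_o.
have [ps|ps] := ltnP p.+1 (size (E i)); first by have [_ _ _ ->] := @vtx_inner i p.+1 ps.
have -> : p.+1 = size (E i) by apply/eqP; rewrite eqn_leq hp ps.
by rewrite vtx_size pos_o' !(negPf (heven _)).
Qed.

Definition upper x := odd (pos x).
Definition prv b := vtx (blk b) (pos b).-1.
Definition nxt b := vtx (blk b) (pos b).+1.

Lemma upper_pos b : upper b -> 0 < pos b < size (E (blk b)).
Proof.
rewrite /upper => hb; rewrite odd_gt0 //= ltn_neqAle pos_le andbT.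
by apply: contraTneq hb => ->; apply: heven.
Qed.

(** Upper vertices are inner, hence lie on a single path and have no neighbours
    besides those along it. *)
Lemma upper_adj a b : upper b -> adj a b = (a == prv b) || (a == nxt b).
Proof.
move=> hb; have /andP[p0 ps] := upper_pos hb.
have unique i p : p <= size (E i) -> b = vtx i p -> i = blk b /\ p = pos b.
  move=> hp bE; have op : odd p by rewrite -(odd_pos_vtx hp) -bE.
  have in_p : 0 < p < size (E i).
    case: (ltngtP p (size (E i))) hp op => // [_ _|->]; first by case: p bE.
    by rewrite (negPf (heven i)).
  by have [_ _ bi pi] := vtx_inner in_p; rewrite bE bi pi.
apply/idP/idP => [/melon_adjP[i [p [hp [[-> bE]|[bE ->]]]]]|].
- by have [iE pE] := unique _ _ hp bE; rewrite /prv -iE -pE eqxx.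
- by have [iE pE] := unique _ _ (ltnW hp) bE; rewrite /nxt -iE -pE eqxx orbT.
case/orP => /eqP ->; apply/melon_adjP; exists (blk b).
  by exists (pos b).-1; split; [lia|left; rewrite prednK // vtx_pos].
by exists (pos b); split=> //; right; rewrite vtx_pos.
Qed.

Definition inc x := lex #|G| (blk x) (pos x).
Definition dec x := lex #|G| (blk x) (#|G|.-1 - pos x).

(** The shift by one keeps inner vertices above the end of rank 0. *)
Definition rank1 x := if x == o' then 0 else if x == o then (m * #|G|).+1 else (dec x).+1.
Definition rank2 x := if x == o then 0 else if x == o' then (m * #|G|).+1 else (inc x).+1.
Definition rank3 x := if (x == o) || (x == o') then 0 else m * #|G| - inc x.

Lemma rank_inner x : x != o -> x != o' ->
  [/\ rank1 x = (dec x).+1, rank2 x = (inc x).+1 & rank3 x = m * #|G| - inc x].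
Proof. by rewrite /rank1 /rank2 /rank3 => /negPf -> /negPf ->. Qed.

Lemma inc_lt x : inc x < m * #|G|.
Proof. by rewrite -[m * #|G|]addn0; apply: ltn_lex_hi (ltn_ord _); apply: pos_lt_card. Qed.

Lemma dec_lt x : dec x < m * #|G|.
Proof.
rewrite -[m * #|G|]addn0; apply: ltn_lex_hi (ltn_ord _).
by have := pos_lt_card x; lia.
Qed.

Lemma inc_dec_blk_lt x y : blk x < blk y -> inc x < inc y /\ dec x < dec y.
Proof.
have := pos_lt_card x => hx h.
by split; apply: ltn_lex_hi h; lia.
Qed.

Lemma inc_dec_pos_lt x y :
  blk x = blk y -> pos x < pos y -> inc x < inc y /\ dec y < dec x.
Proof.
rewrite /inc /dec /lex => -> h; rewrite !ltn_add2l.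
by have := pos_lt_card y; split=> //; lia.
Qed.

(** Inner vertices are reversed between rankings 2 and 3, [o] drops from the top
    of ranking 1 to the bottom of ranking 2, and [o'] the other way round. *)
Lemma rank_incomparable a a' : a != a' ->
  [\/ rank1 a < rank1 a', rank2 a < rank2 a' | rank3 a < rank3 a'].
Proof.
have [[_ oo'] _ _ _ _] := hmelon.
have o'o : (o' == o) = false by rewrite eq_sym (negPf oo').
case: (altP (a =P o)) => [->|ao] aa'.
  by constructor 2; rewrite /rank2 eqxx eq_sym (negPf aa'); case: ifP.
case: (altP (a =P o')) aa' => [->|ao'] aa'.
  by constructor 1; rewrite /rank1 eqxx eq_sym (negPf aa'); case: ifP.
have [r1 r2 r3] := rank_inner ao ao'; have := inc_lt a; have := dec_lt a.
case: (altP (a' =P o)) aa' => [->|a'o] aa'.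
  by constructor 1; rewrite r1 /rank1 (negPf oo') eqxx.
case: (altP (a' =P o')) aa' => [->|a'o'] aa'.
  by constructor 2; rewrite r2 /rank2 o'o eqxx.
have [r1' r2' r3'] := rank_inner a'o a'o'; have := inc_lt a'.
rewrite r2 r2' r3 r3' => h1 h2 h3.
have : inc a != inc a'.
  apply/eqP => e; case: (ltngtP (blk a) (blk a')) => [/inc_dec_blk_lt|/inc_dec_blk_lt|/val_inj be].
  - by lia.
  - by lia.
  - move: e; rewrite /inc /lex be => /addnI pe.
    by move: aa'; rewrite -(vtx_pos a) -(vtx_pos a') be pe eqxx.
by rewrite neq_ltn => /orP[] h; [constructor 2|constructor 3]; lia.
Qed.

(** The next three lemmas list what an inner vertex exceeds in each ranking. *)
Lemma rank1_lt x a : a != o -> a != o' -> x != o ->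
  (x != o' -> blk x < blk a \/ blk x = blk a /\ pos a < pos x) ->
  rank1 x < rank1 a.
Proof.
move=> ao ao' xo hx; have [-> _ _] := rank_inner ao ao'.
case: (altP (x =P o')) hx => [-> _|xo' /(_ isT) hx]; first by rewrite /rank1 eqxx.
have [-> _ _] := rank_inner xo xo'; rewrite ltnS.
by case: hx => [/inc_dec_blk_lt[]|[/esym be /(inc_dec_pos_lt be)[]]].
Qed.

Lemma rank2_lt x a : a != o -> a != o' -> x != o' ->
  (x != o -> blk x < blk a \/ blk x = blk a /\ pos x < pos a) ->
  rank2 x < rank2 a.
Proof.
move=> ao ao' xo' hx; have [_ -> _] := rank_inner ao ao'.
case: (altP (x =P o)) hx => [-> _|xo /(_ isT) hx]; first by rewrite /rank2 eqxx.
have [_ -> _] := rank_inner xo xo'; rewrite ltnS.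
by case: hx => [/inc_dec_blk_lt[]|[be /(inc_dec_pos_lt be)[]]].
Qed.

Lemma rank3_lt x a : a != o -> a != o' ->
  (x != o -> x != o' -> blk a < blk x) -> rank3 x < rank3 a.
Proof.
move=> ao ao' hx; have [_ _ ->] := rank_inner ao ao'; have ia := inc_lt a.
rewrite /rank3; case: ifP => [_|/negbT/norP[xo xo']]; first by rewrite subn_gt0.
have [lt_ax _] := inc_dec_blk_lt (hx xo xo').
by apply: ltn_sub2l.
Qed.

Lemma rank1_lt_o x : x != o -> rank1 x < rank1 o.
Proof.
have [[_ oo'] _ _ _ _] := hmelon; rewrite /rank1 (negPf oo') eqxx => /negPf ->.
by case: ifP => // _; rewrite ltnS dec_lt.
Qed.

Lemma rank2_lt_o' x : x != o' -> rank2 x < rank2 o'.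
Proof.
have [[_ oo'] _ _ _ _] := hmelon.
rewrite /rank2 [o' == o]eq_sym (negPf oo') eqxx => /negPf ->.
by case: ifP => // _; rewrite ltnS inc_lt.
Qed.

(** Each lower vertex outside a subdivided edge is above it in some ranking.
    For an inner vertex [a] of a later block than [b], ranking 1 works unless
    the edge contains [o], ranking 2 works unless it contains [o'], and ranking
    3 works for the remaining case of an edge joining [o] to [o']. *)
Lemma rank_above a b : ~~ upper a -> upper b -> a != prv b -> a != nxt b ->
  [\/ maxn (rank1 (prv b)) (rank1 (nxt b)) < rank1 a,
      maxn (rank2 (prv b)) (rank2 (nxt b)) < rank2 a
    | maxn (rank3 (prv b)) (rank3 (nxt b)) < rank3 a].
Proof.
move=> ha hb au av; rewrite !gtn_max; have /andP[p0 ps] := upper_pos hb.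
have ps' : (pos b).-1 <= size (E (blk b)) by lia.
have uo' : prv b != o'.
  by apply/eqP; rewrite -(vtx_size (blk b)) => /(vtx_inj ps' (leqnn _)); lia.
have vo : nxt b != o.
  by apply/eqP => /(@vtx_inj (blk b) _ 0 ps isT).
have uP : prv b != o -> blk (prv b) = blk b /\ pos (prv b) = (pos b).-1.
  have [p1|p1] := posnP (pos b).-1; first by rewrite /prv p1 eqxx.
  by have [|_ _] := @vtx_inner (blk b) (pos b).-1; first by lia.
have vP : nxt b != o' -> blk (nxt b) = blk b /\ pos (nxt b) = (pos b).+1.
  have [p1|p1] := ltnP (pos b).+1 (size (E (blk b))).
    by have [_ _] := @vtx_inner (blk b) (pos b).+1 p1.
  have -> : nxt b = o' by rewrite -(vtx_size (blk b)) /nxt; congr vtx; lia.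
  by rewrite eqxx.
case: (altP (a =P o)) au av => [->|ao] au av.
  by constructor 1; rewrite !rank1_lt_o // eq_sym.
case: (altP (a =P o')) au av => [->|ao'] au av.
  by constructor 2; rewrite !rank2_lt_o' // eq_sym.
case: (ltngtP (blk a) (blk b)) => [ab|ba|/val_inj abE].
- by constructor 3; rewrite !rank3_lt // => [_ /vP[->]|/uP[->]].
- case: (altP (nxt b =P o')) => [vE|vo'].
    case: (altP (prv b =P o)) => [uE|uo].
      by constructor 3; rewrite uE vE !rank3_lt // eqxx.
    have [ub _] := uP uo; constructor 1; apply/andP.
    split; apply: rank1_lt => //; last by rewrite vE eqxx.
    by left; rewrite ub.
  have [vb _] := vP vo'; constructor 2; apply/andP.
  split; apply: rank2_lt => //; last by left; rewrite vb.
  by case/uP=> -> _; left.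
have neq_p : pos a != (pos b).-1.
  by apply: contraNneq au => e; rewrite -(vtx_pos a) abE e eqxx.
have neq_n : pos a != (pos b).+1.
  by apply: contraNneq av => e; rewrite -(vtx_pos a) abE e eqxx.
have neq_b : pos a != pos b.
  by apply: contraNneq ha => e; rewrite /upper e.
have a_inner : 0 < pos a < size (E (blk b)).
  rewrite -abE lt0n ltn_neqAle pos_le andbT; apply/andP; split.
    by apply: contraNneq ao => e; rewrite -(vtx_pos a) e.
  by apply: contraNneq ao' => e; rewrite -(vtx_pos a) e vtx_size.
have [qp|qp] := ltnP (pos a) (pos b).
- have uo : prv b != o.
    by apply/eqP => /(@vtx_inj (blk b) _ 0 ps' isT); lia.
  constructor 1; apply/andP; split; apply: rank1_lt => //.
    by move: (uP uo) => [-> ->] _; right; rewrite abE; split=> //; lia.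
  by case/vP=> -> ->; right; rewrite abE; split=> //; lia.
- have vo' : nxt b != o'.
    by apply/eqP; rewrite -(vtx_size (blk b)) => /(vtx_inj ps (leqnn _)); lia.
  constructor 2; apply/andP; split; apply: rank2_lt => //.
    by case/uP=> -> ->; right; rewrite abE; split=> //; lia.
  by move: (vP vo') => [-> ->] _; right; rewrite abE; split=> //; lia.
Qed.

Lemma even_melon_perm_representable3 : perm_representable G 3.
Proof.
pose r (j : 'I_3) := nth rank1 [:: rank1; rank2; rank3] j.
have ex3 (f : (G -> nat) -> bool) :
    [\/ f rank1, f rank2 | f rank3] -> exists j, f (r j).
  case; first by exists ord0.
    by exists (Ordinal (isT : 1 < 3)).
  by exists ord_max.
have end1 b : upper b -> ~~ upper (prv b).
  move=> hb; have /andP[p0 ps] := upper_pos hb.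
  rewrite /upper odd_pos_vtx; last by lia.
  by move: hb; rewrite /upper; lia.
have end2 b : upper b -> ~~ upper (nxt b).
  move=> hb; have /andP[p0 ps] := upper_pos hb.
  by rewrite /upper odd_pos_vtx //= negbK.
apply: (@schnyder G 1 upper prv nxt r) => //.
- move=> b hb; have /andP[p0 ps] := upper_pos hb.
  by apply/eqP => /vtx_inj; lia.
- move=> a b ha hb; apply/negP => /melon_adjP[i [p [hp h]]].
  have := odd_pos_vtx hp; have := odd_pos_vtx (ltnW hp).
  by case: h => -[<- <-]; rewrite -!/(upper _) (negPf ha) (negPf hb) => /= <-.
- exact: upper_adj.
- move=> a a' _ _ aa'; apply: (ex3 (fun f => f a < f a')).
  exact: rank_incomparable.
- move=> a b ha hb n1 n2; apply: (ex3 (fun f => maxn (f _) (f _) < f a)).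
  exact: rank_above.
Qed.

End EvenMelon.

Theorem theorem6 (G : sgraph) (o o' : G) (m : nat) (E : 'I_m -> seq G)
  (hmelon : melon_graph o o' E)
  (hcomp : comparability_graph G)
  (heven : forall i : 'I_m, ~~ odd (size (E i))) :
  exists k : nat, is_perm_rep_number G k /\ k <= 3.
Proof.
have [_ _ _ cover _] := hmelon.
have [blk hblk] := fin_all_exists cover.
exact: is_perm_rep_number_le (even_melon_perm_representable3 hmelon heven hblk).
Qed.
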